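(* Let $T$ and $T'$ be oriented virtual tangles; denote the components of $T$ by $T_i$, with variables $t_i$, initial labels $c_i$ and index differences $\delta_i$, and the components of $T'$ by $T'_j$, with variables $t'_j$, initial labels $c'_j$ and index differences $\delta'_j$. The multi-variable affine index polynomial (MAIP) $p$ is well-behaved under tangle operations: $p_{T\otimes T'}=p_T+p_{T'}$ for any two tangles, and (when the composition is defined) $p_{T\circ T'}=p_T+p_{T'}$ up to the following labeling adjustments: (a) If the end of $T_i$ gets glued to the beginning of $T'_j$, the variable $t'_j$ should be replaced with $t_i$; and if the resulting gluing does not close a component, the ending label of $T_i$ should be set equal to the starting label of $T'_j$, i.e. $c_i+\delta_i=c'_j$, and every occurrence of $c'_j$ in the exponents should be replaced with $c_i+\delta_i$. (b) If $T_{i_1}$ glues to $T'_{j_1}$, $T'_{j_1}$ glues to $T_{i_2}$, $T_{i_2}$ glues to $T'_{j_2}$, and so on up to $T_{i_r}$ gluing to $T'_{j_r}$, to overall form the component $T''_i$ of $T\circ T'$, then each of $\delta_{i_1},\dots,\delta_{i_r},\delta'_{j_1},\dots,\delta'_{j_r}$ must be replaced with the value $$\delta''_i=\sum_{k=1}^r\bigl(\delta_{i_k}+\delta'_{j_k}\bigr)=\delta_{i_1}+\delta'_{j_1}+\delta_{i_2}+\cdots+\delta'_{j_r}.$$ In particular, if $T_i$ is glued to $T'_j$, any occurrence of $\delta_i$ in $p_T$ and any occurrence of $\delta'_j$ in $p_{T'}$ must be substituted with $\delta_i+\delta'_j$.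
   Context: Virtual tangles: a virtual tangle is represented by a diagram in a square: a graph whose vertices are 1-valent (fixed ends, on the top or bottom side of the square) or 4-valent, each 4-valent vertex being a positive or negative classical crossing or a virtual crossing, up to the classical and virtual Reidemeister moves performed away from the 1-valent vertices. Each component is either closed (no 1-valent vertices) or long (exactly two 1-valent vertices). An $(m,n)$-tangle has $m$ ends on the top side and $n$ ends on the bottom side. Components are ordered; an orientation is chosen for each component, and a starting point for each closed component; a long component starts at its initial end. Operations: the tensor product $T\otimes T'$ places $T'$ to the right of $T$ (its components and variables are those of $T$ together with those of $T'$, ordered consistently on both sides of the equality). If $T$ is an $(m,n)$-tangle and $T'$ an $(n,p)$-tangle, the composition $T\circ T'$ is the $(m,p)$-tangle obtained by stacking $T$ above $T'$ and connecting the ends; for oriented tangles it is performed only if the result has a consistent orientation inherited from $T$ and $T'$. Affine labeling: each component starts with an initial label, and labels propagate along the orientation as follows. Draw a classical crossing with both strands oriented upwards. The strand going from bottom left to top right changes its label from $x$ to $x-1$; the strand going from bottom right to top left changes its label from $y$ to $y+1$, irrespective of which strand is over. Labels do not change at virtual crossings. (A crossing is positive exactly when the overstrand goes from bottom left to top right in this picture, negative otherwise.) The index difference of a component is its final label minus its initial label. Weight: for a classical crossing $d$, $W(d)=a-b-\operatorname{sgn}(d)$, where $a$ is the (incoming) label of the overstrand and $b$ the (incoming) label of the understrand. MAIP: for a tangle $T$ with components $T_1,\dots,T_n$, $$p_T(t_1,\dots,t_n)=\sum_{i=1}^n\ \sum_{d:\ T_i\text{ over }T_j}\operatorname{sgn}(d)\,t_i^{\delta_j}\bigl(t_i^{W(d)}-1\bigr),$$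 where the inner sum is over all classical crossings $d$ at which $T_i$ is the overstrand, and $T_j$ denotes the component of the understrand (the case $j=i$ included). The occurrences of $\delta_i$ and $\delta'_j$ referred to in the claim are those in this expression for $p_T$ and $p_{T'}$. *)

(* Defs.v *)
From mathcomp Require Import all_boot all_order all_algebra.

Set Implicit Arguments.
Unset Strict Implicit.
Unset Printing Implicit Defensive.

Import GRing.Theory.
Local Open Scope ring_scope.

Variant crossing_kind := Positive | Negative | Virtual.

(* The points of the strands of a diagram: (d, s) is the passage of a strand
   through the crossing d drawn with both strands upwards, where s = true is the
   strand going from bottom left to top right and s = false the strand going
   from bottom right to top left; 'mark' is a marked (2-valent) point of an arc;
   'top' and 'bot' are the ends, numbered from left to right. *)
Definition point (X M : finType) (m n : nat) : finType :=
  ((X * bool + M) + ('I_m + 'I_n))%type.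

Definition pass {X M : finType} {m n : nat} (d : X) (s : bool) : point X M m n :=
  inl (inl (d, s)).
Definition mark {X M : finType} {m n : nat} (b : M) : point X M m n :=
  inl (inr b).
Definition top {X M : finType} {m n : nat} (i : 'I_m) : point X M m n :=
  inr (inl i).
Definition bot {X M : finType} {m n : nat} (j : 'I_n) : point X M m n :=
  inr (inr j).

(* An oriented diagram with m top ends and n bottom ends. The arcs of the
   diagram are the pairs (q, r) with dsucc q = Some r, oriented from q to r.
   The planar position of the arcs is not recorded: any such graph can be drawn
   in the square, at the cost of virtual crossings, which affect neither the
   components, nor the labels, nor the polynomial. Marked points carry the
   starting points of closed components (dbase), make room for crossing-free
   circles, and are what two ends become once they have been glued. *)
Record diagram (m n : nat) := Diagram {
  crossing : finType;
  kind : crossing -> crossing_kind;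
  marking : finType;
  dsucc : point crossing marking m n -> option (point crossing marking m n);
  dbase : {set marking} }.

Definition dpoint (m n : nat) (D : diagram m n) : finType :=
  point (crossing D) (marking D) m n.

(* The next point along the strand; a final end is its own next point. *)
Definition dnext (m n : nat) (D : diagram m n) (q : dpoint D) : dpoint D :=
  odflt q (dsucc q).

Definition has_pred (m n : nat) (D : diagram m n) (q : dpoint D) : Prop :=
  exists r : dpoint D, dsucc r = Some q.

(* Crossings are 4-valent, marked points 2-valent, ends 1-valent. *)
Record arcs_ok (m n : nat) (D : diagram m n) : Prop := ArcsOk {
  succ_inj : forall q q' r : dpoint D,
    dsucc q = Some r -> dsucc q' = Some r -> q = q';
  inner_succ : forall q, dsucc (inl q : dpoint D) <> None;
  inner_pred : forall q, has_pred (inl q : dpoint D);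
  end_valence : forall e, dsucc (inr e : dpoint D) = None <->
                          has_pred (inr e : dpoint D) }.

(* Long components start at their initial end, closed ones at a base point. *)
Definition start (m n : nat) (D : diagram m n) (q : dpoint D) : bool :=
  match q with
  | inl (inl _) => false
  | inl (inr b) => b \in dbase D
  | inr _ => dsucc q != None
  end.

(* Each component has exactly one starting point. *)
Definition starts_ok (m n : nat) (D : diagram m n) : Prop :=
  forall q : dpoint D, exists! s : dpoint D, start s /\ fconnect (@dnext m n D) s q.

Record tangle (m n : nat) := Tangle {
  tdiag :> diagram m n;
  tangle_arcs : arcs_ok tdiag;
  tangle_starts : starts_ok tdiag }.

Arguments tangle_arcs {m n} t.
Arguments tangle_starts {m n} t.

(* Components, identified with their starting points. *)
Definition component (m n : nat) (D : diagram m n) : finType :=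
  {q : dpoint D | start q}.

Definition on_comp (m n : nat) (D : diagram m n) (i : component D) (q : dpoint D) :
  bool := fconnect (@dnext m n D) (val i) q.

Definition classical (m n : nat) (D : diagram m n) (d : crossing D) : bool :=
  if kind d is Virtual then false else true.

Definition sgn (m n : nat) (D : diagram m n) (d : crossing D) : int :=
  match kind d with Positive => 1 | Negative => -1 | Virtual => 0 end.

Definition over (m n : nat) (D : diagram m n) (d : crossing D) : dpoint D :=
  pass d (if kind d is Positive then true else false).
Definition under (m n : nat) (D : diagram m n) (d : crossing D) : dpoint D :=
  pass d (if kind d is Positive then false else true).

(* Change of the label when a strand goes through a point. *)
Definition turn (m n : nat) (D : diagram m n) (q : dpoint D) : int :=
  if q is inl (inl (d, s)) then
    if classical d then (if s then -1 else 1) else 0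
  else 0.

(* Incoming label at the point q of the i-th component, c being the family of
   initial labels. *)
Definition label (m n : nat) (D : diagram m n) (c : component D -> int) (i : component D)
    (q : dpoint D) : int :=
  c i + \sum_(k < findex (@dnext m n D) (val i) q)
          turn (iter k (@dnext m n D) (val i)).

(* The points of the i-th component are the iterates of order < 'order'. *)
Definition final_label (m n : nat) (D : diagram m n) (c : component D -> int)
    (i : component D) : int :=
  c i + \sum_(k < fingraph.order (@dnext m n D) (val i))
          turn (iter k (@dnext m n D) (val i)).

Definition index_diff (m n : nat) (D : diagram m n) (c : component D -> int)
    (i : component D) : int := final_label c i - c i.

(* i is the component of the overstrand, j that of the understrand. *)
Definition weight (m n : nat) (D : diagram m n) (c : component D -> int)
    (i j : component D) (d : crossing D) : int :=
  label c i (over d) - label c j (under d) - sgn d.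

(* The expression defining the polynomial, as a function of the variables t, of
   the initial labels c and of the exponents dl occurring in its prefactors
   t_i ^ dl_j, so that each of them can be substituted. The variables range over
   the units of any commutative ring; Laurent polynomials are the generic case. *)
Definition maip_expr (R : comUnitRingType) (m n : nat) (D : diagram m n)
    (t : component D -> R) (c dl : component D -> int) : R :=
  \sum_(i : component D) \sum_(j : component D)
    \sum_(d : crossing D |
          [&& classical d, on_comp i (over d) & on_comp j (under d)])
      (sgn d)%:~R * t i ^ dl j * (t i ^ weight c i j d - 1).

Definition maip (R : comUnitRingType) (m n : nat) (D : diagram m n)
    (t : component D -> R) (c : component D -> int) : R :=
  maip_expr t c (index_diff c).

Section Tensor.
Variables (m n m' n' : nat).

Definition tens_l (D : diagram m n) (D' : diagram m' n') (q : dpoint D) :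
    point (crossing D + crossing D')%type (marking D + marking D')%type
      (m + m') (n + n') :=
  match q with
  | inl (inl (d, s)) => pass (inl d) s
  | inl (inr b) => mark (inl b)
  | inr (inl i) => top (lshift m' i)
  | inr (inr j) => bot (lshift n' j)
  end.

Definition tens_r (D : diagram m n) (D' : diagram m' n') (q : dpoint D') :
    point (crossing D + crossing D')%type (marking D + marking D')%type
      (m + m') (n + n') :=
  match q with
  | inl (inl (d, s)) => pass (inr d) s
  | inl (inr b) => mark (inr b)
  | inr (inl i) => top (rshift m i)
  | inr (inr j) => bot (rshift n j)
  end.

Definition tens_split (D : diagram m n) (D' : diagram m' n')
    (q : point (crossing D + crossing D')%type (marking D + marking D')%type
           (m + m') (n + n')) : (dpoint D + dpoint D')%type :=
  match q with
  | inl (inl (inl d, s)) => inl (pass d s)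
  | inl (inl (inr d, s)) => inr (pass d s)
  | inl (inr (inl b)) => inl (mark b)
  | inl (inr (inr b)) => inr (mark b)
  | inr (inl i) =>
      match split i with inl i1 => inl (top i1) | inr i2 => inr (top i2) end
  | inr (inr j) =>
      match split j with inl j1 => inl (bot j1) | inr j2 => inr (bot j2) end
  end.

Definition tens_diag (D : diagram m n) (D' : diagram m' n') :
    diagram (m + m') (n + n') :=
  @Diagram (m + m') (n + n') (crossing D + crossing D')%type
    (fun d => match d with inl d1 => kind d1 | inr d2 => kind d2 end)
    (marking D + marking D')%type
    (fun q => match tens_split q with
              | inl q1 => omap (@tens_l D D') (dsucc q1)
              | inr q2 => omap (@tens_r D D') (dsucc q2)
              end)
    [set b | match b with inl b1 => b1 \in dbase D
                        | inr b2 => b2 \in dbase D' end].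

Lemma tens_lK (D : diagram m n) (D' : diagram m' n') (q : dpoint D) :
  tens_split (tens_l D' q) = inl q.
Proof.
case: q => [[[d s]|b]|[i|j]] //=.
  by case: (split_ordP _) => k /eqP; rewrite ?eq_shift // => /eqP ->.
by case: (split_ordP _) => k /eqP; rewrite ?eq_shift // => /eqP ->.
Qed.

Lemma tens_rK (D : diagram m n) (D' : diagram m' n') (q : dpoint D') :
  tens_split (tens_r D q) = inr q.
Proof.
case: q => [[[d s]|b]|[i|j]] //=.
  by case: (split_ordP _) => k /eqP; rewrite ?eq_shift // => /eqP ->.
by case: (split_ordP _) => k /eqP; rewrite ?eq_shift // => /eqP ->.
Qed.

Lemma tens_lI (D : diagram m n) (D' : diagram m' n') : injective (@tens_l D D').
Proof. by move=> q r /(congr1 (@tens_split D D')); rewrite !tens_lK => -[]. Qed.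

Lemma tens_rI (D : diagram m n) (D' : diagram m' n') : injective (@tens_r D D').
Proof. by move=> q r /(congr1 (@tens_split D D')); rewrite !tens_rK => -[]. Qed.

Lemma tens_lr (D : diagram m n) (D' : diagram m' n') q r :
  @tens_l D D' q <> @tens_r D D' r.
Proof. by move/(congr1 (@tens_split D D')); rewrite tens_lK tens_rK. Qed.

Variant tens_spec (D : diagram m n) (D' : diagram m' n') :
    dpoint (tens_diag D D') -> Prop :=
  | TensL q : @tens_spec D D' (tens_l D' q)
  | TensR q : @tens_spec D D' (tens_r D q).

Lemma tensP (D : diagram m n) (D' : diagram m' n') q : @tens_spec D D' q.
Proof.
case: q => [[[[d|d] s]|[b|b]]|[i|j]].
- exact: (@TensL D D' (pass d s)).
- exact: (@TensR D D' (pass d s)).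
- exact: (@TensL D D' (mark b)).
- exact: (@TensR D D' (mark b)).
- case: (split_ordP i) => k ->; first exact: (@TensL D D' (top k)).
  exact: (@TensR D D' (top k)).
- case: (split_ordP j) => k ->; first exact: (@TensL D D' (bot k)).
  exact: (@TensR D D' (bot k)).
Qed.

Lemma tens_succ_l (D : diagram m n) (D' : diagram m' n') (q : dpoint D) :
  dsucc (tens_l D' q : dpoint (tens_diag D D')) = omap (@tens_l D D') (dsucc q).
Proof. by rewrite /= tens_lK. Qed.

Lemma tens_succ_r (D : diagram m n) (D' : diagram m' n') (q : dpoint D') :
  dsucc (tens_r D q : dpoint (tens_diag D D')) = omap (@tens_r D D') (dsucc q).
Proof. by rewrite /= tens_rK. Qed.

Lemma tens_start_l (D : diagram m n) (D' : diagram m' n') (q : dpoint D) :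
  start (tens_l D' q : dpoint (tens_diag D D')) = start q.
Proof.
have := tens_succ_l D' q.
by case: q => [[[d s]|b]|[i|j]] //= E; rewrite ?inE ?E //; case: dsucc.
Qed.

Lemma tens_start_r (D : diagram m n) (D' : diagram m' n') (q : dpoint D') :
  start (tens_r D q : dpoint (tens_diag D D')) = start q.
Proof.
have := tens_succ_r D q.
by case: q => [[[d s]|b]|[i|j]] //= E; rewrite ?inE ?E //; case: dsucc.
Qed.

Lemma tens_pred_l (D : diagram m n) (D' : diagram m' n') (q : dpoint D) :
  has_pred (tens_l D' q : dpoint (tens_diag D D')) <-> has_pred q.
Proof.
split=> [[r]|[r eq_r]]; last by exists (tens_l D' r); rewrite tens_succ_l eq_r.
case: (tensP r) => r1; rewrite ?tens_succ_l ?tens_succ_r;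
  case eq_r: (dsucc r1) => [r2|] //= [] e.
  by exists r1; rewrite eq_r (tens_lI e).
by case: (tens_lr (esym e)).
Qed.

Lemma tens_pred_r (D : diagram m n) (D' : diagram m' n') (q : dpoint D') :
  has_pred (tens_r D q : dpoint (tens_diag D D')) <-> has_pred q.
Proof.
split=> [[r]|[r eq_r]]; last by exists (tens_r D r); rewrite tens_succ_r eq_r.
case: (tensP r) => r1; rewrite ?tens_succ_l ?tens_succ_r;
  case eq_r: (dsucc r1) => [r2|] //= [] e.
  by case: (tens_lr e).
by exists r1; rewrite eq_r (tens_rI e).
Qed.

Lemma tens_arcs (D : diagram m n) (D' : diagram m' n') :
  arcs_ok D -> arcs_ok D' -> arcs_ok (tens_diag D D').
Proof.
case=> sI iS iP eV [sI' iS' iP' eV']; split.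
- move=> q q' r; case: (tensP q) => q1; case: (tensP q') => q1';
    rewrite ?tens_succ_l ?tens_succ_r;
    case e1: (dsucc q1) => [r1|] //= [<-];
    case e2: (dsucc q1') => [r2|] //= [].
  + by move/tens_lI=> e; rewrite (sI _ _ _ e1 (etrans e2 (congr1 Some e))).
  + by move/esym/tens_lr.
  + by move/tens_lr.
  + by move/tens_rI=> e; rewrite (sI' _ _ _ e1 (etrans e2 (congr1 Some e))).
- move=> [[[d|d] s]|[b|b]] /=.
  + by move: (iS (inl (d, s))); case e: (dsucc _).
  + by move: (iS' (inl (d, s))); case e: (dsucc _).
  + by move: (iS (inr b)); case e: (dsucc _).
  + by move: (iS' (inr b)); case e: (dsucc _).
- move=> [[[d|d] s]|[b|b]].
  + by apply/(tens_pred_l D' (pass d s)); apply: iP.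
  + by apply/(tens_pred_r D (pass d s)); apply: iP'.
  + by apply/(tens_pred_l D' (mark b)); apply: iP.
  + by apply/(tens_pred_r D (mark b)); apply: iP'.
- move=> e; move: (erefl (inr e : dpoint (tens_diag D D'))).
  case: {1}_ / (tensP (inr e)) => q eq_q; rewrite -eq_q.
  + rewrite tens_succ_l; apply: (iff_trans _ (iff_sym (tens_pred_l D' q))).
    case: q eq_q => [[[d s]|b]|e1] // _.
    by apply: (iff_trans _ (eV e1)); case: (dsucc _).
  + rewrite tens_succ_r; apply: (iff_trans _ (iff_sym (tens_pred_r D q))).
    case: q eq_q => [[[d s]|b]|e1] // _.
    by apply: (iff_trans _ (eV' e1)); case: (dsucc _).
Qed.

Lemma tens_iter_l (D : diagram m n) (D' : diagram m' n') k (q : dpoint D) :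
  iter k (@dnext _ _ (tens_diag D D')) (tens_l D' q) =
  tens_l D' (iter k (@dnext _ _ D) q).
Proof.
by elim: k => //= k ->; rewrite /dnext tens_succ_l; case: (dsucc _).
Qed.

Lemma tens_iter_r (D : diagram m n) (D' : diagram m' n') k (q : dpoint D') :
  iter k (@dnext _ _ (tens_diag D D')) (tens_r D q) =
  tens_r D (iter k (@dnext _ _ D') q).
Proof.
by elim: k => //= k ->; rewrite /dnext tens_succ_r; case: (dsucc _).
Qed.

Lemma tens_starts (D : diagram m n) (D' : diagram m' n') :
  starts_ok D -> starts_ok D' -> starts_ok (tens_diag D D').
Proof.
move=> sD sD' q; case: (tensP q) => {}q.
- have [s [[st_s /iter_findex con_s] uniq_s]] := sD q.
  exists (tens_l D' s); split.
    rewrite tens_start_l; split=> //.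
    by rewrite -con_s -tens_iter_l fconnect_iter.
  move=> r [st_r /iter_findex]; move: (findex _ _ _) => k.
  case: (tensP r) st_r => r1; rewrite ?tens_start_l ?tens_start_r => st_r.
    rewrite tens_iter_l => /tens_lI e; rewrite (uniq_s r1) //; split=> //.
    by rewrite -e fconnect_iter.
  by rewrite tens_iter_r => e; case: (tens_lr (esym e)).
- have [s [[st_s /iter_findex con_s] uniq_s]] := sD' q.
  exists (tens_r D s); split.
    rewrite tens_start_r; split=> //.
    by rewrite -con_s -tens_iter_r fconnect_iter.
  move=> r [st_r /iter_findex]; move: (findex _ _ _) => k.
  case: (tensP r) st_r => r1; rewrite ?tens_start_l ?tens_start_r => st_r.
    by rewrite tens_iter_l => e; case: (tens_lr e).
  rewrite tens_iter_r => /tens_rI e; rewrite (uniq_s r1) //; split=> //.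
  by rewrite -e fconnect_iter.
Qed.

Definition tensor (T : tangle m n) (T' : tangle m' n') :
    tangle (m + m') (n + n') :=
  Tangle (tens_arcs (tangle_arcs T) (tangle_arcs T'))
         (tens_starts (tangle_starts T) (tangle_starts T')).

Lemma tens_start_l_val (T : tangle m n) (T' : tangle m' n') (i : component T) :
  start (tens_l T' (val i) : dpoint (tensor T T')).
Proof. by have := valP i; rewrite -(tens_start_l T'). Qed.

Lemma tens_start_r_val (T : tangle m n) (T' : tangle m' n') (j : component T') :
  start (tens_r T (val j) : dpoint (tensor T T')).
Proof. by have := valP j; rewrite -(tens_start_r T). Qed.

Definition tens_component_l (T : tangle m n) (T' : tangle m' n') (i : component T) :
    component (tensor T T') := Sub _ (tens_start_l_val T' i).

Definition tens_component_r (T : tangle m n) (T' : tangle m' n') (j : component T') :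
    component (tensor T T') := Sub _ (tens_start_r_val T j).

End Tensor.

(* Gluing the k-th bottom end of D to the k-th top end of D', for all k. *)
Section Glue.
Variables (m n p : nat) (D : diagram m n) (D' : diagram n p).

(* The orientations of D and D' agree at the glued ends. *)
Definition composable : Prop :=
  forall k : 'I_n,
    (dsucc (bot k : dpoint D) == None) = (dsucc (top k : dpoint D') != None).

Local Notation gpoint :=
  (point (crossing D + crossing D')%type
         (marking D + marking D' + 'I_n)%type m p).

Definition glue_l (q : dpoint D) : gpoint :=
  match q with
  | inl (inl (d, s)) => pass (inl d) s
  | inl (inr b) => mark (inl (inl b))
  | inr (inl i) => top i
  | inr (inr k) => mark (inr k)
  end.

Definition glue_r (q : dpoint D') : gpoint :=
  match q with
  | inl (inl (d, s)) => pass (inr d) s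
  | inl (inr b) => mark (inl (inr b))
  | inr (inl k) => mark (inr k)
  | inr (inr j) => bot j
  end.

Definition glue_succ (q : gpoint) : option gpoint :=
  let next_l (r : dpoint D) := omap glue_l (dsucc r) in
  let next_r (r : dpoint D') := omap glue_r (dsucc r) in
  match q with
  | inl (inl (inl d, s)) => next_l (pass d s)
  | inl (inl (inr d, s)) => next_r (pass d s)
  | inl (inr (inl (inl b))) => next_l (mark b)
  | inl (inr (inl (inr b))) => next_r (mark b)
  | inl (inr (inr k)) =>
      if dsucc (bot k : dpoint D) == None then next_r (top k) else next_l (bot k)
  | inr (inl i) => next_l (top i)
  | inr (inr j) => next_r (bot j)
  end.

(* B is the set of glued points chosen as starting points of the closed
   components created by the gluing. *)
Definition glue_diag (B : {set 'I_n}) : diagram m p :=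
  @Diagram m p (crossing D + crossing D')%type
    (fun d => match d with inl d1 => kind d1 | inr d2 => kind d2 end)
    (marking D + marking D' + 'I_n)%type
    glue_succ
    [set b | match b with inl (inl b1) => b1 \in dbase D
                        | inl (inr b2) => b2 \in dbase D'
                        | inr k => k \in B end].

Lemma glue_lI : injective glue_l.
Proof. by move=> [[[d s]|b]|[i|k]] [[[d' s']|b']|[i'|k']] //= []; do ?move->. Qed.

Lemma glue_rI : injective glue_r.
Proof. by move=> [[[d s]|b]|[i|k]] [[[d' s']|b']|[i'|k']] //= []; do ?move->. Qed.

Lemma glue_lr q r : glue_l q = glue_r r -> exists2 k, q = bot k & r = top k.
Proof.
by case: q r => [[[d s]|b]|[i|k]] [[[d' s']|b']|[k'|j']] //= [->]; exists k'.
Qed.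

(* The successor of a glued point comes from the side that the strand enters. *)
Lemma glue_succE q q' : glue_succ q = Some q' ->
  (exists q1 r1, [/\ q = glue_l q1, dsucc q1 = Some r1 & q' = glue_l r1]) \/
  (exists q2 r2, [/\ q = glue_r q2, dsucc q2 = Some r2 & q' = glue_r r2]).
Proof.
have L q1 : omap glue_l (dsucc q1) = Some q' ->
    exists r1, dsucc q1 = Some r1 /\ q' = glue_l r1.
  by case e: (dsucc q1) => [r1|] //= [<-]; exists r1.
have R q2 : omap glue_r (dsucc q2) = Some q' ->
    exists r2, dsucc q2 = Some r2 /\ q' = glue_r r2.
  by case e: (dsucc q2) => [r2|] //= [<-]; exists r2.
case: q => [[[[d|d] s]|[[b|b]|k]]|[i|j]] /=.
- by case/L=> r []; left; exists (pass d s), r.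
- by case/R=> r []; right; exists (pass d s), r.
- by case/L=> r []; left; exists (mark b), r.
- by case/R=> r []; right; exists (mark b), r.
- case: ifP => _; first by case/R=> r []; right; exists (top k), r.
  by case/L=> r []; left; exists (bot k), r.
- by case/L=> r []; left; exists (top i), r.
- by case/R=> r []; right; exists (bot j), r.
Qed.

Lemma glue_succ_l q r : dsucc q = Some r -> glue_succ (glue_l q) = Some (glue_l r).
Proof. by case: q => [[[d s]|b]|[i|k]] /= ->. Qed.

Lemma glue_succ_r : composable -> forall q r,
  dsucc q = Some r -> glue_succ (glue_r q) = Some (glue_r r).
Proof.
move=> hor [[[d s]|b]|[k|j]] r /= e; rewrite ?e //.
by have := hor k; rewrite e /= => /eqP ->; rewrite eqxx.
Qed.

Lemma glue_arcs (B : {set 'I_n}) :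
  composable -> arcs_ok D -> arcs_ok D' -> arcs_ok (glue_diag B).
Proof.
move=> hor [sI iS iP eV] [sI' iS' iP' eV'].
have mixed q1 r1 q2 r2 : dsucc q1 = Some r1 -> dsucc q2 = Some r2 ->
    glue_l r1 = glue_r r2 -> False.
  move=> e1 e2 /glue_lr[k r1E r2E]; have := hor k.
  have /eV-> : has_pred (inr (inr k) : dpoint D) by exists q1; rewrite e1 r1E.
  have /eV'-> // : has_pred (inr (inl k) : dpoint D').
  by exists q2; rewrite e2 r2E.
have predl q : has_pred q -> has_pred (glue_l q : dpoint (glue_diag B)).
  by case=> r /glue_succ_l e; exists (glue_l r).
have predr q : has_pred q -> has_pred (glue_r q : dpoint (glue_diag B)).
  by case=> r /(glue_succ_r hor) e; exists (glue_r r).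
split.
- move=> q q' r /glue_succE[] [q1 [r1 [-> e1 ->]]] /glue_succE[]
    [q2 [r2 [-> e2]]].
  + by move/glue_lI=> e; rewrite (sI _ _ _ e1 (etrans e2 (congr1 Some (esym e)))).
  + by move/mixed => /(_ _ _ e1 e2).
  + by move/esym/mixed => /(_ _ _ e2 e1).
  + by move/glue_rI=> e; rewrite (sI' _ _ _ e1 (etrans e2 (congr1 Some (esym e)))).
- move=> [[[d|d] s]|[[b|b]|k]] /=.
  + by move: (iS (inl (d, s))); case e: (dsucc _).
  + by move: (iS' (inl (d, s))); case e: (dsucc _).
  + by move: (iS (inr b)); case e: (dsucc _).
  + by move: (iS' (inr b)); case e: (dsucc _).
  + by have := hor k; case: eqP; case: (dsucc (bot k)); case: (dsucc (top k)).
- move=> [[[d|d] s]|[[b|b]|k]].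
  + exact: (predl (pass d s) (iP _)).
  + exact: (predr (pass d s) (iP' _)).
  + exact: (predl (mark b) (iP _)).
  + exact: (predr (mark b) (iP' _)).
  + have := hor k; case: eqP => [/eV ek _|_ /esym /negbFE /eqP /eV' ek].
      exact: (predl (bot k)).
    exact: (predr (top k)).
- move=> [i|j]; split.
  + move=> /= e; apply: (predl (top i)); apply/eV.
    by move: e; rewrite /top; case: (dsucc _).
  + case=> q /glue_succE[] [q1 [r1 [_ e1]]] rE.
      have r1E : r1 = top i by apply: glue_lI; rewrite -rE.
      have e : dsucc (top i : dpoint D) = None.
        by apply/eV; exists q1; rewrite e1 r1E.
      by rewrite /= e.
    by case: r1 rE {e1} => [[[d s]|b]|[k|j]].
  + move=> /= e; apply: (predr (bot j)); apply/eV'.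
    by move: e; rewrite /bot; case: (dsucc _).
  + case=> q /glue_succE[] [q1 [r1 [_ e1]]] rE.
      by case: r1 rE {e1} => [[[d s]|b]|[i|k]].
    have r1E : r1 = bot j by apply: glue_rI; rewrite -rE.
    have e : dsucc (bot j : dpoint D') = None.
      by apply/eV'; exists q1; rewrite e1 r1E.
    by rewrite /= e.
Qed.

(* The components of D and D'. *)
Definition part : finType := (component D + component D')%type.

Definition part_diff (c : part -> int) (u : part) : int :=
  match u with
  | inl i => index_diff (c \o inl) i
  | inr j => index_diff (c \o inr) j
  end.

(* At the k-th glued point, the end of u is glued to the beginning of v. *)
Definition glued_at (k : 'I_n) (u v : part) : bool :=
  match u, v with
  | inl i, inr j =>
      [&& on_comp i (bot k), dsucc (bot k : dpoint D) == None
        & val j == top k]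
  | inr j, inl i =>
      [&& on_comp j (top k), dsucc (top k : dpoint D') == None
        & val i == bot k]
  | _, _ => false
  end.

(* The gluings that do not close a component. *)
Definition glued (B : {set 'I_n}) : rel part :=
  fun u v => [exists k : 'I_n, (k \notin B) && glued_at k u v].

(* The component l of the result begins with the component u. *)
Definition begins (B : {set 'I_n}) (l : component (glue_diag B)) (u : part) : bool :=
  val l == match u with inl i => glue_l (val i) | inr j => glue_r (val j) end.

(* The components u :: s, each glued to the following one, overall form the
   component l of the result. *)
Definition forms (B : {set 'I_n}) (l : component (glue_diag B)) (u : part)
    (s : seq part) : Prop :=
  [/\ begins l u, path (glued B) u s & forall v, ~~ glued B (last u s) v].

End Glue.

(* The hypothesis on B says that exactly one glued point has been chosen on each
   closed component created by the gluing, and none on the other components. *)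
Definition composition (m n p : nat) (T : tangle m n) (T' : tangle n p)
    (B : {set 'I_n}) (hor : composable T T') (hB : starts_ok (glue_diag T T' B)) :
    tangle m p :=
  Tangle (glue_arcs B hor (tangle_arcs T) (tangle_arcs T')) hB.

(* Main.v *)
(* Gluing two tangles identifies ends of their components (the parts) with
   marked points of the result, and neither ends nor marked points turn a label.
   Walking along a component l of the result from its start, induction on the
   point reached shows that the label on l is the label on the part being
   traversed: inside a part both obey the same recursion, and at a glued point
   which is not a chosen starting point hypothesis (a) makes the final label of
   one part the initial label of the next one. The same walk shows that all the
   parts lying on l follow one another from the first one, so they are exactly
   the parts of the chain that forms l, each occurring once. Since an index
   difference is the sum of the turns at the passages through crossings, that of
   l is the sum over the chain, and the two polynomials agree crossing by
   crossing. *)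
Require Import Defs.
From mathcomp Require Import all_boot all_order all_algebra.
Import GRing.Theory.
Local Open Scope ring_scope.

Set Implicit Arguments.
Unset Strict Implicit.
Unset Printing Implicit Defensive.

(** * Paths of relations that are functional or injective *)

(** A first repeated vertex is not [u], which has no predecessor; its two occurrences would have the
    same predecessor, which would be an earlier repetition. *)
Lemma path_uniq_copartial (T : eqType) (e : rel T) (u : T) (s : seq T) :
  (forall x y z, e x z -> e y z -> x = y) -> (forall x, ~~ e x u) ->
  path e u s -> uniq (u :: s).
Proof.
move=> eI e_u; elim/last_ind: s => [//|s x IHs].
rewrite rcons_path -rcons_cons rcons_uniq => /andP[ps ex].
rewrite (IHs ps) andbT; apply/negP; rewrite inE => /orP[/eqP xu|].
  by move: ex; rewrite xu (negPf (e_u _)).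
move/path.splitPr => sx; case: sx ps ex IHs => s1 s2.
rewrite last_cat => ps /= e2 /(_ ps); move: ps; rewrite cat_path /= => /and3P[_ e1 _].
rewrite -[_ && _]/(uniq ((u :: s1) ++ x :: s2)) cat_uniq => /and3P[_ /hasP[]].
exists (last x s2); first exact: mem_last.
by rewrite -(eI _ _ _ e1 e2); apply: mem_last.
Qed.

(** As [e] is functional, a path from [u] is a prefix of the maximal one. *)
Lemma mem_maximal_path (T : eqType) (e : rel T) (u : T) (s p : seq T) :
  (forall x y z, e x y -> e x z -> y = z) ->
  path e u s -> (forall v, ~~ e (last u s) v) -> path e u p -> last u p \in u :: s.
Proof.
move=> eF; elim: p u s => [|x p IHp] u s; first by rewrite mem_head.
case: s => [|y s] /=; first by move=> _ /(_ x)/negPf->.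
move=> /andP[uy ps] sM /andP[ux pp]; rewrite -(eF _ _ _ ux uy) in ps sM *.
by rewrite inE IHp ?orbT.
Qed.

Lemma exists_maximal_path (T : finType) (e : rel T) (u : T) :
  (forall x y z, e x z -> e y z -> x = y) -> (forall x, ~~ e x u) ->
  exists2 s, path e u s & forall v, ~~ e (last u s) v.
Proof.
move=> eI e_u.
(* [k] bounds the number of extensions still possible: paths from [u] have no repetition, so none
   has more than [#|T|] vertices. *)
suff max k s : path e u s -> (#|T| <= size s + k)%N ->
    exists2 s, path e u s & forall v, ~~ e (last u s) v.
  exact: (max #|T| [::]).
elim: k s => [|k IHk] s ps.
  rewrite addn0 leqNgt => /negP[].
  by have /card_uniqP/= <- := path_uniq_copartial eI e_u ps; apply: max_card.
case: (pickP (e (last u s))) => [v ev|noe] s_k; last by exists s => // v; rewrite noe.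
by apply: (IHk (rcons s v)); rewrite ?rcons_path ?ps // size_rcons addSnnS.
Qed.

(** * Walking along one component *)

Section Strands.
Variables (m n : nat) (T : tangle m n).
Implicit Types (i : component T) (q r : dpoint T) (c : component T -> int).

Lemma on_comp_val i : on_comp i (val i).
Proof. exact: connect0. Qed.

Lemma on_comp_exists q : exists i, on_comp i q.
Proof. by have [s [[st_s cq] _]] := tangle_starts T q; exists (Sub s st_s). Qed.

Lemma on_comp_inj i i' q : on_comp i q -> on_comp i' q -> i = i'.
Proof.
have [s [_ sU]] := tangle_starts T q => iq i'q; apply: val_inj.
by rewrite -(sU (val i)) ?(sU (val i')) //; split=> //; apply: valP.
Qed.

Lemma on_comp_eq i i' q : on_comp i q -> on_comp i' q = (i' == i).
Proof. by move=> iq; apply/idP/eqP => [/on_comp_inj/(_ iq)|->]. Qed.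

Lemma on_comp_start i q : on_comp i q -> start q -> q = val i.
Proof. by move=> iq sq; rewrite (on_comp_inj iq (on_comp_val (Sub q sq))). Qed.

Lemma dnext_succ q r : dsucc q = Some r -> dnext q = r.
Proof. by rewrite /dnext => ->. Qed.

Lemma dnext_final q : dsucc q = None -> dnext q = q.
Proof. by rewrite /dnext => ->. Qed.

Lemma on_comp_succ i q r : on_comp i q -> dsucc q = Some r -> on_comp i r.
Proof.
move=> iq /dnext_succ <-; exact: connect_trans iq (fconnect1 _ _).
Qed.

Lemma start_succ q : start q -> dsucc q <> None.
Proof.
by case: q => [[[d s]|b]|e] //=; [move=> _; apply: (inner_succ (tangle_arcs T))|move/eqP].
Qed.

Lemma pred_start q r : dsucc q = Some r -> start r -> exists2 b, r = mark b & b \in dbase T.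
Proof.
case: r => [[[d s]|b]|e] //= qr; first by exists b.
by have [_ ->] := end_valence (tangle_arcs T) e; last by exists q.
Qed.

Lemma final_end q : dsucc q = None -> exists e, q = inr e.
Proof. by case: q => [q /(inner_succ (tangle_arcs T))|e _] //; exists e. Qed.

(** The walk along a closed component comes back to its start, where the recursion for labels
    breaks; this return is already covered by the base case, whence [r != val i]. *)
Lemma on_comp_ind i (P : dpoint T -> Prop) :
  P (val i) ->
  (forall q r, on_comp i q -> P q -> dsucc q = Some r -> r != val i -> P r) ->
  forall q, on_comp i q -> P q.
Proof.
move=> P0 PS q /iter_findex <-; elim: (findex _ _ _) => //= k IHk.
case E: (dsucc (iter k (@dnext _ _ T) (val i))) => [r|]; last by rewrite dnext_final.
rewrite (dnext_succ E); have [-> //|ri] := eqVneq r (val i).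
by apply: PS E ri => //; apply: fconnect_iter.
Qed.

(** A final end is fixed by [dnext], so the walk never leaves the first one it meets. *)
Lemma on_comp_final_inj i q r : on_comp i q -> on_comp i r ->
  dsucc q = None -> dsucc r = None -> q = r.
Proof.
move=> iq ir qN rN.
have stay x k : dsucc x = None -> iter k (@dnext _ _ T) x = x.
  by move=> /dnext_final xx; elim: k => //= k ->.
have := iter_findex iq; have := iter_findex ir.
move: (findex _ _ r) (findex _ _ q) => b a rE qE.
case/orP: (leq_total a b) => /subnK ab.
  by rewrite -ab iterD qE stay in rE.
by rewrite -ab iterD rE stay in qE.
Qed.

Lemma label_val c i : label c i (val i) = c i.
Proof. by rewrite /label findex0 big_ord0 addr0. Qed.

Lemma label_succ c i q r : on_comp i q -> dsucc q = Some r -> r != val i ->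
  label c i r = label c i q + turn q.
Proof.
move=> iq qr ri; have ir := on_comp_succ iq qr.
suff fr : findex (@dnext _ _ T) (val i) r = (findex (@dnext _ _ T) (val i) q).+1.
  by rewrite /label fr big_ord_recr /= iter_findex // addrA.
have := findex_max ir; have := iter_findex ir.
case: (findex _ _ r) => [/= e|k /= e k_lt]; first by rewrite -e eqxx in ri.
(* The point of rank [k] must be [q]. If it has a successor, this is [r], and arcs are injective; if
   not, the walk is stationary there and [r] could not have rank [k.+1]. *)
congr _.+1; rewrite -(@findex_iter _ (@dnext _ _ T) (val i) k) ?(ltnW k_lt) //.
congr findex; case E: (dsucc (iter k (@dnext _ _ T) (val i))) => [r'|].
  by rewrite (dnext_succ E) in e; apply: (succ_inj (tangle_arcs T) E); rewrite qr e.
have := @findex_iter _ _ (val i) _ k_lt; rewrite /= dnext_final //.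
by rewrite findex_iter ?(ltnW k_lt) // => /n_Sn.
Qed.

(** A final end is the last point of the orbit, and its own turn is zero, so the incoming label
    there is already the final label. *)
Lemma label_final c i q : on_comp i q -> dsucc q = None ->
  label c i q = c i + index_diff c i.
Proof.
move=> iq qN; rewrite /index_diff addrC subrK /final_label /label.
have k_lt := findex_max iq; have eq_q := iter_findex iq.
suff <- : (findex (@dnext _ _ T) (val i) q).+1 = fingraph.order (@dnext _ _ T) (val i).
  by rewrite big_ord_recr /= eq_q; case: (final_end qN) => e ->; rewrite addr0.
apply/eqP; rewrite eqn_leq k_lt leqNgt; apply/negP => /findex_iter.
by rewrite /= eq_q dnext_final // => /n_Sn.
Qed.

(** The orbit meets each point of the component once, and only passages through crossings turn. This
    form forgets the order of the walk, hence the starting point. *)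
Lemma index_diff_sum c i :
  index_diff c i =
  \sum_(d : crossing T) \sum_(s : bool | on_comp i (pass d s)) turn (pass d s : dpoint T).
Proof.
rewrite /index_diff /final_label addrC addKr.
transitivity (\sum_(q | on_comp i q) turn q).
  rewrite (eq_bigl (mem (orbit (@dnext _ _ T) (val i)))) => [|q]; last first.
    exact: fconnect_orbit.
  rewrite -big_uniq ?orbit_uniq //= (big_nth (val i)) size_traject big_mkord.
  by apply: eq_bigr => k _; rewrite nth_traject.
rewrite big_sumType /= [X in _ + X]big1 // addr0.
rewrite big_sumType /= [X in _ + X]big1 // addr0.
by rewrite pair_big_dep; apply: eq_big => [[d s]|[d s] _].
Qed.

End Strands.

(** * The polynomial as a sum over crossings *)

Section Crossings.
Variables (m n : nat) (T : tangle m n).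

Definition comp_at (q : dpoint T) : component T := xchoose (on_comp_exists q).

Lemma comp_atP q : on_comp (comp_at q) q.
Proof. exact: (xchooseP (on_comp_exists q)). Qed.

Lemma comp_at_eq i q : on_comp i q -> comp_at q = i.
Proof. exact: on_comp_inj (comp_atP q). Qed.

Lemma on_compE i q : on_comp i q = (i == comp_at q).
Proof. exact: on_comp_eq (comp_atP q). Qed.

Definition crossing_term (R : comUnitRingType) (t : component T -> R)
    (c dl : component T -> int) (i j : component T) (d : crossing T) : R :=
  (sgn d)%:~R * t i ^ dl j * (t i ^ weight c i j d - 1).

(** A classical crossing contributes to exactly one pair of components. Sums over crossings split
    along the two factors of an operation, unlike sums over components of a composition. *)
Lemma maip_expr_crossings (R : comUnitRingType) (t : component T -> R)
    (c dl : component T -> int) :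
  maip_expr t c dl =
  \sum_(d : crossing T | classical d)
    crossing_term t c dl (comp_at (Defs.over d)) (comp_at (under d)) d.
Proof.
rewrite /maip_expr pair_bigA (exchange_big_dep (@classical _ _ T)) /= => [|u d _ /andP[]//].
apply: eq_bigr => d d_cl.
rewrite (big_pred1 (comp_at (Defs.over d), comp_at (under d))) // => -[i j].
by rewrite d_cl !on_compE.
Qed.

End Crossings.

(** * Injections of diagrams that commute with the walk *)

Section Embedding.
Variables (m n m0 n0 : nat) (D : diagram m n) (D0 : diagram m0 n0).
Variables (g : dpoint D -> dpoint D0) (h : component D -> component D0).
Hypothesis g_inj : injective g.
Hypothesis g_turn : forall q, turn (g q) = turn q.
Hypothesis g_iter : forall k q, iter k (@dnext _ _ D0) (g q) = g (iter k (@dnext _ _ D) q).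
Hypothesis val_h : forall i, val (h i) = g (val i).

Lemma embed_on_comp i q : on_comp i q -> on_comp (h i) (g q).
Proof. by rewrite /on_comp val_h => /iter_findex <-; rewrite -g_iter fconnect_iter. Qed.

(** The orbit of [g q] is the image of the orbit of [q]. *)
Lemma embed_order q :
  fingraph.order (@dnext _ _ D0) (g q) = fingraph.order (@dnext _ _ D) q.
Proof.
rewrite /fingraph.order -(card_image g_inj); apply: eq_card => r.
apply/idP/imageP => [/iter_findex <-|[r' /iter_findex <- ->]].
  by rewrite g_iter; exists (iter (findex (@dnext _ _ D0) (g q) r) (@dnext _ _ D) q);
     rewrite // inE fconnect_iter.
by rewrite inE -g_iter fconnect_iter.
Qed.

Lemma embed_findex q r :
  findex (@dnext _ _ D0) (g q) (g r) = findex (@dnext _ _ D) q r.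
Proof.
rewrite /findex /orbit embed_order -(index_map g_inj); congr index.
apply: (@eq_from_nth _ (g q)) => [|k]; rewrite ?size_map !size_traject // => k_lt.
by rewrite nth_traject // (nth_map q) ?size_traject // nth_traject.
Qed.

Lemma embed_label (c : component D0 -> int) i q :
  label c (h i) (g q) = label (c \o h) i q.
Proof.
rewrite /label val_h embed_findex; congr (_ + _).
by apply: eq_bigr => k _; rewrite g_iter g_turn.
Qed.

Lemma embed_index_diff (c : component D0 -> int) i :
  index_diff c (h i) = index_diff (c \o h) i.
Proof.
rewrite /index_diff /final_label val_h embed_order; congr (_ + _ - _).
by apply: eq_bigr => k _; rewrite g_iter g_turn.
Qed.

End Embedding.

(** * The tensor product *)

Section TensorMaip.
Variables (m n m' n' : nat) (T : tangle m n) (T' : tangle m' n').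

Lemma tens_turn_l (q : dpoint T) : turn (tens_l T' q : dpoint (tensor T T')) = turn q.
Proof. by case: q => [[[]|]|[]]. Qed.

Lemma tens_turn_r (q : dpoint T') : turn (tens_r T q : dpoint (tensor T T')) = turn q.
Proof. by case: q => [[[]|]|[]]. Qed.

Lemma maip_tensor (R : comUnitRingType) (t : component (tensor T T') -> R)
    (c : component (tensor T T') -> int) :
  maip t c =
    maip (fun i : component T => t (tens_component_l T' i))
         (fun i : component T => c (tens_component_l T' i)) +
    maip (fun j : component T' => t (tens_component_r T j))
         (fun j : component T' => c (tens_component_r T j)).
Proof.
have vl (i : component T) : val (tens_component_l T' i) = tens_l T' (val i) by [].
have vr (j : component T') : val (tens_component_r T j) = tens_r T (val j) by [].
have on_l := embed_on_comp (@tens_iter_l _ _ _ _ T T') vl.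
have on_r := embed_on_comp (@tens_iter_r _ _ _ _ T T') vr.
have at_l q : @comp_at _ _ (tensor T T') (tens_l T' q) = tens_component_l T' (comp_at q).
  exact: (@comp_at_eq _ _ (tensor T T') _ _ (on_l _ _ (comp_atP q))).
have lab_l := @embed_label _ _ _ _ _ (tensor T T') _ _ (@tens_lI _ _ _ _ T T')
  tens_turn_l (@tens_iter_l _ _ _ _ T T') vl.
have at_r q : @comp_at _ _ (tensor T T') (tens_r T q) = tens_component_r T (comp_at q).
  exact: (@comp_at_eq _ _ (tensor T T') _ _ (on_r _ _ (comp_atP q))).
have lab_r := @embed_label _ _ _ _ _ (tensor T T') _ _ (@tens_rI _ _ _ _ T T')
  tens_turn_r (@tens_iter_r _ _ _ _ T T') vr.
have dif_l := @embed_index_diff _ _ _ _ _ (tensor T T') _ _ (@tens_lI _ _ _ _ T T')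
  tens_turn_l (@tens_iter_l _ _ _ _ T T') vl.
have dif_r := @embed_index_diff _ _ _ _ _ (tensor T T') _ _ (@tens_rI _ _ _ _ T T')
  tens_turn_r (@tens_iter_r _ _ _ _ T T') vr.
rewrite /maip !maip_expr_crossings big_sumType /=; congr (_ + _); apply: eq_bigr => d _.
- have ov : Defs.over (inl d : crossing (tensor T T')) = tens_l T' (Defs.over d) by [].
  have un : under (inl d : crossing (tensor T T')) = tens_l T' (under d) by [].
  rewrite ov un !at_l.
  by rewrite /crossing_term /weight ov un !lab_l dif_l.
- have ov : Defs.over (inr d : crossing (tensor T T')) = tens_r T (Defs.over d) by [].
  have un : under (inr d : crossing (tensor T T')) = tens_r T (under d) by [].
  rewrite ov un !at_r.
  by rewrite /crossing_term /weight ov un !lab_r dif_r.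
Qed.

End TensorMaip.

(** * The two factors of a composition as one disjoint union *)

Section Parts.
Variables (m n p : nat) (T : tangle m n) (T' : tangle n p).
Implicit Types (c : part T T' -> int) (u v w : part T T').

(** With the points of both factors in one type, a strand that alternates between the factors is
    followed without distinguishing sides. *)
Definition part_point : Type := (dpoint T + dpoint T')%type.
Implicit Types q r : part_point.

Definition part_succ q : option part_point :=
  match q with inl q => omap inl (dsucc q) | inr q => omap inr (dsucc q) end.

Definition part_start q : bool :=
  match q with inl q => start q | inr q => start q end.

Definition part_turn q : int :=
  match q with inl q => turn q | inr q => turn q end.

Definition part_beg u : part_point :=
  match u with inl i => inl (val i) | inr j => inr (val j) end.

Definition on_part u q : bool :=
  match u, q with
  | inl i, inl q => on_comp i q
  | inr j, inr q => on_comp j q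
  | _, _ => false
  end.

Definition part_at q : part T T' :=
  match q with inl q => inl (comp_at q) | inr q => inr (comp_at q) end.

(** The value 0 is a dummy, for a point and a part on different sides. *)
Definition part_label c u q : int :=
  match u, q with
  | inl i, inl q => label (c \o inl) i q
  | inr j, inr q => label (c \o inr) j q
  | _, _ => 0
  end.

Lemma part_atP q : on_part (part_at q) q.
Proof. by case: q => q; apply: comp_atP. Qed.

Lemma on_part_inj u v q : on_part u q -> on_part v q -> u = v.
Proof. by case: u v q => [i|i] [j|j] [q|q] //= iq /(on_comp_inj iq)->. Qed.

Lemma on_part_beg u : on_part u (part_beg u).
Proof. by case: u => i; apply: on_comp_val. Qed.

Lemma on_part_start u q : on_part u q -> part_start q -> q = part_beg u.
Proof. by case: u q => [i|i] [q|q] //= iq /(on_comp_start iq)->. Qed.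

Lemma part_start_beg u : part_start (part_beg u).
Proof. by case: u => i; apply: valP. Qed.

Lemma on_part_succ u q r : on_part u q -> part_succ q = Some r -> on_part u r.
Proof.
case: u q => [i|i] [q|q] //= iq; case E: (dsucc q) => [q'|] //= [<-];
  exact: on_comp_succ E.
Qed.

Lemma part_start_succ q : part_start q -> part_succ q <> None.
Proof. by case: q => q /= /start_succ; case: (dsucc q). Qed.

Lemma part_succ_pass_l (d : crossing T) b : part_succ (inl (pass d b)) <> None.
Proof. by have := @inner_succ _ _ _ (tangle_arcs T) (inl (d, b)); rewrite /=; case: dsucc. Qed.

Lemma part_succ_pass_r (d : crossing T') b : part_succ (inr (pass d b)) <> None.
Proof. by have := @inner_succ _ _ _ (tangle_arcs T') (inl (d, b)); rewrite /=; case: dsucc. Qed.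

Lemma part_label_beg c u : part_label c u (part_beg u) = c u.
Proof. by case: u => i; rewrite /= label_val. Qed.

Lemma part_label_succ c u q r : on_part u q -> part_succ q = Some r ->
  r != part_beg u -> part_label c u r = part_label c u q + part_turn q.
Proof.
case: u q => [i|i] [q|q] //= iq; case E: (dsucc q) => [q'|] //= [<-] r_i;
  by rewrite /= (label_succ _ iq E).
Qed.

Lemma part_label_final c u q : on_part u q -> part_succ q = None ->
  part_label c u q = c u + part_diff c u.
Proof.
by case: u q => [i|i] [q|q] //= iq; case E: (dsucc q) => // _; rewrite (label_final _ iq E).
Qed.

Lemma on_part_ind u (P : part_point -> Prop) :
  P (part_beg u) -> (forall q r, P q -> part_succ q = Some r -> P r) ->
  forall q, on_part u q -> P q.
Proof.
move=> P0 PS; case: u P0 => i P0 [q|q] // iq.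
- apply: (@on_comp_ind _ _ T i (fun x => P (inl x)) P0 _ q iq) => {iq q}q r _ Pq qr _.
  by apply: PS Pq _; rewrite /= qr.
- apply: (@on_comp_ind _ _ T' i (fun x => P (inr x)) P0 _ q iq) => {iq q}q r _ Pq qr _.
  by apply: PS Pq _; rewrite /= qr.
Qed.

End Parts.

(** * Components of the composition as chains of parts *)

Section Gluing.
Variables (m n p : nat) (T : tangle m n) (T' : tangle n p) (B : {set 'I_n}).
Hypotheses (hor : composable T T') (hB : starts_ok (glue_diag T T' B)).
Local Notation C := (composition hor hB).
Implicit Types (u v w : part T T') (l : component C) (q r : part_point T T').

Definition glue q : dpoint C :=
  match q with inl q => glue_l T' q | inr q => glue_r T q end.

Lemma glue_succ_some q r : part_succ q = Some r -> dsucc (glue q) = Some (glue r).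
Proof.
case: q => q /=; case E: (dsucc q) => [q'|] //= [<-].
  exact: glue_succ_l E.
exact: glue_succ_r E.
Qed.

Lemma glue_succ_inv (x y : dpoint C) : dsucc x = Some y ->
  exists q r, [/\ x = glue q, part_succ q = Some r & y = glue r].
Proof.
by case/glue_succE => -[q [r [-> E ->]]]; [exists (inl q), (inl r)|exists (inr q), (inr r)];
  rewrite /= E.
Qed.

(* Two points of the parts are identified only when they are glued ends. *)
Lemma glue_eq q r : glue r = glue q -> part_succ q <> None ->
  r = q \/ exists k : 'I_n, glue q = mark (inr k) /\
    forall u v, on_part u r -> on_part v q -> part_start q /\
       part_succ r = None /\ glued_at k u v.
Proof.
case: q r => q [] r //=.
- by move/glue_lI=> ->; left.
(* Composability gives a successor to exactly one of the two glued ends. It is [q] here, so [q]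
   starts its part and [r] is final. *)
- move/esym/glue_lr=> [k -> ->]; have := hor k; case E: dsucc => [x|] //= hk _.
  right; exists k; split=> // -[i|i] [j|j] //= ik jk; rewrite E; split=> //.
  have E' : dsucc (top k : dpoint T') = None by move/esym/negbFE/eqP: hk.
  rewrite E'; split=> //; rewrite ik /=; apply/eqP/esym/on_comp_start => //=.
  by rewrite E.
- move/glue_lr=> [k -> ->]; have := hor k; case E: (dsucc (top k)) => [x|] //= hk _.
  right; exists k; split=> // -[i|i] [j|j] //= ik jk; rewrite E; split=> //.
  rewrite (eqP hk); split=> //; rewrite ik eqxx /=; apply/eqP/esym/on_comp_start => //=.
  by rewrite E.
- by move/glue_rI=> ->; left.
Qed.

Lemma glue_start q : start (glue q) -> part_succ q <> None -> part_start q.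
Proof.
by case: q => [[[[d s]|b]|[i|k]]|[[[d s]|b]|[k|j]]] //=; rewrite ?inE //;
  case: (dsucc _).
Qed.

Lemma glue_mark_start k : start (mark (inr k) : dpoint C) = (k \in B).
Proof. by rewrite /= inE. Qed.

(** A start with a predecessor is a base point of a factor, and gluing keeps these as base
    points. *)
Lemma glue_pred_start q r : part_succ q = Some r -> part_start r -> start (glue r).
Proof.
case: q r => q [] r /=; case E: (dsucc q) => [r'|] //= [<-];
  by case/(pred_start E) => b -> bB; rewrite /= inE.
Qed.

Lemma glue_turn q : turn (glue q) = part_turn q.
Proof. by case: q => [[[[]|]|[]]|[[[]|]|[]]]. Qed.

Lemma beginsE l u : begins l u = (val l == glue (part_beg u)).
Proof. by case: u. Qed.

Lemma begins_beg l u q : glue q = val l -> part_succ q <> None -> on_part u q ->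
  begins l u /\ q = part_beg u.
Proof.
move=> ql qN uq; have sl := valP l; rewrite -ql in sl.
have q_beg := on_part_start uq (glue_start sl qN).
by rewrite beginsE -q_beg ql.
Qed.

Lemma beg_succ u : part_succ (part_beg u) <> None.
Proof. exact/part_start_succ/part_start_beg. Qed.

(** If the starts of two distinct parts were identified, one of them would be a final end, but a
    start has a successor. *)
Lemma begins_inj l u v : begins l u -> begins l v -> u = v.
Proof.
rewrite !beginsE => /eqP-> /eqP /glue_eq/(_ (@beg_succ v)) [e|[k [_ /(_ u v)]]].
  by apply: on_part_inj (on_part_beg u) _; rewrite e on_part_beg.
case; rewrite ?on_part_beg // => _ [uN _].
by case: (@beg_succ u).
Qed.

Lemma begins_exists l : exists u, begins l u.
Proof.
have sl := valP l.
have [x lx] : exists x, dsucc (val l) = Some x.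
  by have := start_succ sl; case: dsucc => // x; exists x.
have [q [r [lq qr _]]] := glue_succ_inv lx; exists (part_at q).
by case: (@begins_beg l (part_at q) q); rewrite ?part_atP ?qr.
Qed.

Definition part_on l u := on_comp l (glue (part_beg u)).

(** Arcs of [u] remain arcs after gluing, so the component through the start of [u] contains all of
    [u]; the converse follows as components are disjoint. *)
Lemma part_on_glue l u q : on_part u q -> on_comp l (glue q) = part_on l u.
Proof.
move=> uq; rewrite /part_on.
suff : forall l, on_comp l (glue (part_beg u)) -> on_comp l (glue q).
  move=> to_q; apply/idP/idP=> [lq|]; last exact: to_q.
  by have := comp_atP (glue (part_beg u)); rewrite (on_comp_inj lq (to_q _ (comp_atP _))).
move=> {}l; elim/on_part_ind: q / uq => // q r lq qr {}/lq lq.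
exact: on_comp_succ lq (glue_succ_some qr).
Qed.

Lemma glued_at_glue k u v : glued_at k u v ->
  exists q, [/\ on_part u q, part_succ q = None, glue q = mark (inr k)
              & glue (part_beg v) = mark (inr k)].
Proof.
case: u v => [i|i] [j|j] //= /and3P[ik /eqP E /eqP->].
  by exists (inl (bot k)); rewrite /= E.
by exists (inr (top k)); rewrite /= E.
Qed.

(** A part has at most one final end. *)
Lemma glued_functional u v w : glued B u v -> glued B u w -> v = w.
Proof.
move=> /existsP[k /andP[_ uv]] /existsP[k' /andP[_ uw]].
case: u v w uv uw => [i|i] [v|v] [w|w] //=;
  move=> /and3P[ik /eqP E /eqP vk] /and3P[ik' /eqP E' /eqP wk];
  have [kk'] := on_comp_final_inj ik ik' E E'; congr (_ _); apply: val_inj;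
  by rewrite /= vk wk kk'.
Qed.

(** The start of [w] determines the glued point, whose other side lies on a single part. *)
Lemma glued_cofunctional u v w : glued B u w -> glued B v w -> u = v.
Proof.
move=> /existsP[k /andP[_ uw]] /existsP[k' /andP[_ vw]].
case: w u v uw vw => [w|w] [u|u] [v|v] //= /and3P[uk _ /eqP wk] /and3P[vk _ /eqP];
  by rewrite wk => -[kk']; rewrite -kk' in vk; rewrite (on_comp_inj uk vk).
Qed.

(** The glued point would be the start of [l], hence in [B], and [glued] excludes those points. *)
Lemma glued_begins l u v : begins l v -> ~~ glued B u v.
Proof.
rewrite beginsE => /eqP lv.
apply/existsP => -[k /andP[/negP kB /glued_at_glue[q [_ _ _ vk]]]].
by apply: kB; rewrite -glue_mark_start -vk -lv; apply: valP.
Qed.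

Lemma glued_part_on l u v : glued B u v -> part_on l u = part_on l v.
Proof.
move=> /existsP[k /andP[_ /glued_at_glue[q [uq _ qk vk]]]].
by rewrite -(part_on_glue l uq) qk -vk (part_on_glue l (on_part_beg v)).
Qed.

(** * Labels and index differences on the composition *)

Section Labels.
Variables (R : Type) (t : part T T' -> R) (c : part T T' -> int).
Variables (t'' : component C -> R) (c'' : component C -> int).
Hypothesis begins_tc : forall l u, begins l u -> t'' l = t u /\ c'' l = c u.
Hypothesis glued_tc : forall (k : 'I_n) u v, glued_at k u v ->
  t v = t u /\ (k \notin B -> c v = c u + part_diff c u).

(** Two parts meet at a glued point; asking for a successor of [q] selects the one that the strand
    enters. At a point of [B] the final label of the part that arrives there may differ from the
    label at the start. *)
Lemma glue_label l u v q : begins l u -> on_part v q -> part_succ q <> None ->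
  part_on l v ->
  [/\ label c'' l (glue q) = part_label c v q, t'' l = t v & connect (glued B) u v].
Proof.
move=> lu vq qN lv; rewrite -(part_on_glue l vq) in lv.
(* The part and its point are quantified inside [P], because they change when the walk crosses a
   glued point. *)
pose P x := forall v q, on_part v q -> part_succ q <> None -> glue q = x ->
  [/\ label c'' l x = part_label c v q, t'' l = t v & connect (glued B) u v].
suff: P (glue q) by move/(_ v q vq qN erefl).
have [t_l c_l] := begins_tc lu.
move: (glue q) lv; apply: on_comp_ind => {v vq q qN}.
  move=> v q vq qN qx; have [lv ->] := begins_beg qx qN vq.
  by rewrite (begins_inj lv lu) label_val part_label_beg.
move=> x y lx Px xy yl v q vq qN qy.
have [q1 [r1 [xE q1r1 yE]]] := glue_succ_inv xy.
have q1N : part_succ q1 <> None by rewrite q1r1.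
have [lab1 t1 con1] := Px _ _ (part_atP q1) q1N (esym xE).
have v1r1 := on_part_succ (part_atP q1) q1r1.
have yN : ~~ start y.
  by apply: contra yl => /(on_comp_start (on_comp_succ lx xy))->.
rewrite (label_succ _ lx xy yl) lab1 xE glue_turn.
have := glue_eq (etrans (esym yE) (esym qy)) qN.
(* Either the arc ends inside the same part, or it reaches a glued point where [v] starts. *)
case=> [r1q|[k [qk /(_ _ _ v1r1 vq)[q_st [r1N v1v]]]]].
  have <- : part_at q1 = v by apply: on_part_inj v1r1 _; rewrite r1q.
  rewrite -r1q (part_label_succ _ (part_atP q1) q1r1) //.
  (* If [r1] were the start of its part, [y] would be the start of [l], which the induction
     excludes. *)
  apply: contra yN => /eqP r1_beg; rewrite yE; apply: (glue_pred_start q1r1).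
  by rewrite r1_beg part_start_beg.
(* As [y] is not a start, the gluing does not close a component, and (a) equates the labels. *)
have kB : k \notin B by rewrite -glue_mark_start -qk qy.
have [t_v /(_ kB) c_v] := glued_tc v1v.
rewrite {1}(on_part_start vq q_st) part_label_beg c_v t_v -(part_label_final _ v1r1 r1N).
rewrite (part_label_succ _ (part_atP q1) q1r1); last first.
  by apply/eqP=> r1_beg; case: (@beg_succ (part_at q1)); rewrite -r1_beg.
split=> //; apply: connect_trans con1 (connect1 _).
by apply/existsP; exists k; rewrite kB.
Qed.

Lemma part_on_connect l u v : begins l u -> part_on l v -> connect (glued B) u v.
Proof.
by move=> lu lv; case: (glue_label lu (on_part_beg v) (@beg_succ v) lv).
Qed.

(** Parts on [l] are reached from [u] by gluings, and the chain is the only maximal path from [u];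
    conversely, gluing stays on one component. *)
Lemma forms_mem l u s v : forms l u s -> part_on l v = (v \in u :: s).
Proof.
case=> lu us sM; apply/idP/idP => [/(part_on_connect lu)/connectP[s' us' ->]|].
  exact: (mem_maximal_path glued_functional).
have : part_on l u by rewrite beginsE in lu; rewrite /part_on -(eqP lu) on_comp_val.
elim: s u us {lu sM} => [|w s IHs] u /=; first by rewrite inE => _ lu /eqP->.
move=> /andP[uw ws] lu; rewrite inE => /orP[/eqP-> //|].
by apply: IHs ws _; rewrite -(glued_part_on l uw).
Qed.

Lemma forms_uniq l u s : forms l u s -> uniq (u :: s).
Proof.
case=> lu us _; apply: path_uniq_copartial us; first exact: glued_cofunctional.
by move=> x; apply: glued_begins lu.
Qed.

Lemma forms_exists l : exists u s, forms l u s.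
Proof.
have [u lu] := begins_exists l.
have [s us sM] := exists_maximal_path glued_cofunctional (fun x => glued_begins x lu).
by exists u, s.
Qed.

(** Both sides add up the turns at the passages on [l], grouped by part on the right. No label is
    compared, so closed components need no separate case. *)
Lemma glue_index_diff l :
  index_diff c'' l = \sum_(w | part_on l w) part_diff c w.
Proof.
rewrite index_diff_sum big_sumType [RHS]big_sumType /=.
(* Stated for an abstract factor [T1], so as to serve for both sides: a passage lies on exactly one
   component of [T1]. *)
have swap m1 n1 (T1 : tangle m1 n1) (h : component T1 -> part T T')
    (e : dpoint T1 -> dpoint C) (c1 : component T1 -> int) :
    (forall i d s, on_comp i (pass d s) -> on_comp l (e (pass d s)) = part_on l (h i)) ->
  \sum_(i | part_on l (h i)) index_diff c1 i =
  \sum_(d : crossing T1) \sum_(s : bool | on_comp l (e (pass d s)))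
     turn (pass d s : dpoint T1).
  move=> eh; under eq_bigr do rewrite index_diff_sum.
  rewrite exchange_big; apply: eq_bigr => d _.
  rewrite (exchange_big_dep xpredT) //= [RHS]big_mkcond; apply: eq_bigr => s _.
  have ix := comp_atP (pass d s : dpoint T1); rewrite (eh _ _ _ ix).
  have [li|/negP li] := boolP (part_on l (h (comp_at (pass d s : dpoint T1)))).
    rewrite (big_pred1 (comp_at (pass d s : dpoint T1))) // => i.
    rewrite /= on_compE; case: eqP => [->|]; rewrite ?andbF ?li //.
  by rewrite big1 // => i /andP[hi]; rewrite on_compE => /eqP e_i; rewrite e_i in hi.
congr (_ + _); apply/esym.
- by apply: (swap _ _ T inl (glue \o inl)) => i d s ix; apply: (part_on_glue l (u := inl i)).
- by apply: (swap _ _ T' inr (glue \o inr)) => i d s ix; apply: (part_on_glue l (u := inr i)).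
Qed.

Lemma forms_index_diff l u s : forms l u s ->
  index_diff c'' l = \sum_(w <- u :: s) part_diff c w.
Proof.
move=> lus; rewrite glue_index_diff (eq_bigl _ _ (fun v => forms_mem v lus)).
by rewrite -big_uniq // (forms_uniq lus).
Qed.

End Labels.

Lemma maip_glue (R : comUnitRingType) (t : part T T' -> R) (c dl : part T T' -> int)
    (t'' : component C -> R) (c'' : component C -> int) :
  (forall l u, begins l u -> t'' l = t u /\ c'' l = c u) ->
  (forall (k : 'I_n) u v, glued_at k u v ->
    t v = t u /\ (k \notin B -> c v = c u + part_diff c u)) ->
  (forall l u s, forms l u s ->
    forall v, v \in u :: s -> dl v = \sum_(w <- u :: s) part_diff c w) ->
  maip t'' c'' =
    maip_expr (t \o inl) (c \o inl) (dl \o inl) + maip_expr (t \o inr) (c \o inr) (dl \o inr).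
Proof.
move=> begins_tc glued_tc dlE.
(* Hypothesis (b) speaks of chains only; it reaches every part because each component is formed by
   some chain. *)
have dif q (v := part_at q) : index_diff c'' (comp_at (glue q)) = dl v.
  have lv : part_on (comp_at (glue q)) v by rewrite -(part_on_glue _ (part_atP q)) comp_atP.
  have [u [s lus]] := forms_exists (comp_at (glue q)).
  rewrite (forms_index_diff begins_tc glued_tc lus) (dlE _ _ _ lus) //.
  by rewrite -(forms_mem begins_tc glued_tc _ lus).
have lab q (v := part_at q) : part_succ q <> None ->
    label c'' (comp_at (glue q)) (glue q) = part_label c v q /\ t'' (comp_at (glue q)) = t v.
  move=> qN; have lv : part_on (comp_at (glue q)) v.
    by rewrite -(part_on_glue _ (part_atP q)) comp_atP.
  have [u lu] := begins_exists (comp_at (glue q)).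
  by have [] := glue_label begins_tc glued_tc lu (part_atP q) qN lv.
rewrite /maip !maip_expr_crossings big_sumType /=; congr (_ + _); apply: eq_bigr => d _.
(* A passage through a crossing always has a successor, so labels transfer at both strands. *)
- have [labo to] := lab (inl (Defs.over d : dpoint T)) (@part_succ_pass_l _ _ _ _ _ _ _).
  have [labu _] := lab (inl (under d : dpoint T)) (@part_succ_pass_l _ _ _ _ _ _ _).
  have difu := dif (inl (under d : dpoint T)).
  rewrite /crossing_term /weight.
  have -> : Defs.over (inl d : crossing C) = glue (inl (Defs.over d)) by [].
  have -> : under (inl d : crossing C) = glue (inl (under d)) by [].
  by rewrite labo to labu difu.
- have [labo to] := lab (inr (Defs.over d : dpoint T')) (@part_succ_pass_r _ _ _ _ _ _ _).
  have [labu _] := lab (inr (under d : dpoint T')) (@part_succ_pass_r _ _ _ _ _ _ _).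
  have difu := dif (inr (under d : dpoint T')).
  rewrite /crossing_term /weight.
  have -> : Defs.over (inr d : crossing C) = glue (inr (Defs.over d)) by [].
  have -> : under (inr d : crossing C) = glue (inr (under d)) by [].
  by rewrite labo to labu difu.
Qed.
End Gluing.

Theorem proposition3p1p2 :
  (forall (m n m' n' : nat) (T : tangle m n) (T' : tangle m' n')
      (R : comUnitRingType) (t : component (tensor T T') -> R)
      (c : component (tensor T T') -> int),
    (forall i, t i \is a GRing.unit) ->
    maip t c =
      maip (fun i : component T => t (tens_component_l T' i))
           (fun i : component T => c (tens_component_l T' i)) +
      maip (fun j : component T' => t (tens_component_r T j))
           (fun j : component T' => c (tens_component_r T j)))
  /\
  (forall (m n p : nat) (T : tangle m n) (T' : tangle n p) (B : {set 'I_n})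
      (hor : composable T T') (hB : starts_ok (glue_diag T T' B))
      (R : comUnitRingType)
      (t : part T T' -> R) (c dl : part T T' -> int)
      (t'' : component (composition hor hB) -> R)
      (c'' : component (composition hor hB) -> int),
    (forall u, t u \is a GRing.unit) ->
    (* the components of the composition keep the variable and the initial
       label of the component with which they begin *)
    (forall (l : component (glue_diag T T' B)) u, begins l u -> t'' l = t u /\ c'' l = c u) ->
    (* (a) *)
    (forall k u v, glued_at k u v ->
      t v = t u /\ (k \notin B -> c v = c u + part_diff c u)) ->
    (* (b) *)
    (forall (l : component (glue_diag T T' B)) u s, forms l u s ->
      forall v, v \in u :: s -> dl v = \sum_(w <- u :: s) part_diff c w) ->
    (forall (l : component (glue_diag T T' B)) u s, forms l u s ->
      index_diff c'' l = \sum_(w <- u :: s) part_diff c w) /\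
    maip t'' c'' =
      maip_expr (fun i : component T => t (inl i)) (fun i : component T => c (inl i))
                (fun i : component T => dl (inl i)) +
      maip_expr (fun j : component T' => t (inr j)) (fun j : component T' => c (inr j))
                (fun j : component T' => dl (inr j))).
Proof.
split=> [m n m' n' T T' R t c _|m n p T T' B hor hB R t c dl t'' c'' _ begins_tc glued_tc dlE].
  exact: maip_tensor.
by split=> [l u s|]; [apply: forms_index_diff begins_tc glued_tc _ _ _|exact: maip_glue].
Qed.
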